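(* Let $k$ be a field with $\mathrm{ch}(k)\neq2$, $G=\mathrm{GL}_3\times\mathrm{GL}_2\times\mathrm{GL}_2\times\mathrm{GL}_1$ and $V=\wedge^2\mathbb{A}^3\oplus\mathbb{A}^3\otimes\mathrm{M}_2$ with the action, the polynomials $P_1,P_2$ and the map $\Phi:V\to\mathrm{Sym}^2\mathbb{A}^2$ described in the context. Then $G_k\backslash\{x\in V_k\mid P_1(x),P_2(x)\neq0\}$ is in bijective correspondence with $\mathrm{Ex}_2(k)$ by associating to $x\in V_k$ such that $P_1(x),P_2(x)\neq0$ the field generated over $k$ by a root of $\Phi(x)$.
   Context: $\mathrm{Ex}_2(k)$ is the set of conjugacy classes of homomorphisms $\mathrm{Gal}(k^{\mathrm{sep}}/k)\to\mathfrak{S}_2$, i.e. the set of $k$-isomorphism classes of separable extensions of $k$ of degree at most $2$. Let $p_1,p_2,p_3$ be the standard basis of $\mathbb{A}^3$ and $E_{ij}$ the matrix units of $\mathrm{M}_2$ ($2\times2$ matrices). Elements of $V$ are pairs $x=(A,B)$, $A=a_1\,p_1\wedge p_2+a_2\,p_1\wedge p_3+a_3\,p_2\wedge p_3$, $B=p_1\otimes B_1+p_2\otimes B_2+p_3\otimes B_3$, $B_i\in\mathrm{M}_2$. The element $g=(g_1,g_2,g_3,t)\in G$ acts by $A\mapsto t(\wedge^2g_1)A$ and on $B$ by the action in which $g_1$ acts on $\mathbb{A}^3$ in the standard way and $(g_2,g_3)$ acts on $\mathrm{M}_2$ by $M\mapsto g_2M\,{}^tg_3$. $P_1(x)=\det(a_1B_3-a_2B_2+a_3B_1)$.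 $R_{322}=p_1\otimes(-E_{11}+E_{22})+p_2\otimes E_{12}+p_3\otimes E_{21}$, and $P_2(x)$ is the (unique) homogeneous degree $6$ polynomial in $B$ with $P_2(gx)=(\det g_1)^2(\det g_2)^3(\det g_3)^3P_2(x)$ taking the value $1$ at $B=R_{322}$; explicitly, if $\det(u_1B_1+u_2B_2+u_3B_3)=au_1^2+bu_1u_2+cu_1u_3+du_2^2+eu_2u_3+fu_3^2$ then $P_2=4adf+bce-ae^2-dc^2-fb^2$. $R=(p_2\wedge p_3,R_{322})\in V$. $\Phi:V\to\mathrm{Sym}^2\mathbb{A}^2$ (binary quadratic forms in the standard basis $u_1,u_2$ of $\mathbb{A}^2$) is the polynomial map over $k$ characterized by $\Phi(R)=u_1u_2$ and $\Phi(gx)=t(\det g_1)^2(\det g_2)^2(\det g_3)\,g_3\Phi(x)$ for $g=(g_1,g_2,g_3,t)\in G$, where $g_3$ acts on $\mathrm{Sym}^2\mathbb{A}^2$ by $\mathrm{Sym}^2g_3$. *)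

(* Defs.v *)
From HB Require Import structures.
From mathcomp Require Import all_boot all_order all_algebra all_field.
From mathcomp Require Import mpoly.
From mathcomp Require Import ring.

Set Implicit Arguments.
Unset Strict Implicit.
Unset Printing Implicit Defensive.

Import GRing.Theory.
Local Open Scope ring_scope.

(* Predicates T -> Prop play the role of sets, both for orbits and for
   isomorphism classes: [set (fieldExtType k)] of mathcomp-classical is ruled
   out by universe constraints. *)
Definition bij_between (T U : Type) (A : T -> Prop) (B : U -> Prop)
    (f : T -> U) : Prop :=
  [/\ forall x, A x -> B (f x),
      forall x y, A x -> A y -> f x = f y -> x = y
    & forall y, B y -> exists2 x, A x & f x = y].

Section Space.
Variable K : fieldType.

(* (A, B), with A given by its coordinates in the basis p1 /\ p2, p1 /\ p3,
   p2 /\ p3, and B = \sum_i p_i (x) B_i given by i |-> B_i. *)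
Definition V : Type := ('rV[K]_3 * {ffun 'I_3 -> 'M[K]_2})%type.

Record grp := Grp { g1 : 'M[K]_3; g2 : 'M[K]_2; g3 : 'M[K]_2; gt : K }.

Definition G (g : grp) : Prop :=
  [/\ g1 g \in unitmx, g2 g \in unitmx, g3 g \in unitmx & gt g != 0].

Definition wedge (u v : 'cV[K]_3) : 'rV[K]_3 :=
  \row_(l < 3) [:: u 0 0 * v 1 0 - u 1 0 * v 0 0;
                   u 0 0 * v 2%:R 0 - u 2%:R 0 * v 0 0;
                   u 1 0 * v 2%:R 0 - u 2%:R 0 * v 1 0]`_l.

Definition wedge2 (g : 'M[K]_3) (a : 'rV[K]_3) : 'rV[K]_3 :=
  a 0 0 *: wedge (col 0 g) (col 1 g) + a 0 1 *: wedge (col 0 g) (col 2%:R g)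
    + a 0 2%:R *: wedge (col 1 g) (col 2%:R g).

Definition Vact (g : grp) (x : V) : V :=
  (gt g *: wedge2 (g1 g) x.1,
   [ffun i => \sum_j g1 g i j *: (g2 g *m x.2 j *m (g3 g)^T)]).

Definition P1 (x : V) : K :=
  \det (x.1 0 0 *: x.2 2%:R - x.1 0 1 *: x.2 1 + x.1 0 2%:R *: x.2 0).

(* The coefficient of u v in \det (u X + v Y); see [det_lincomb3] below. *)
Definition polar_det (X Y : 'M[K]_2) : K := \det (X + Y) - \det X - \det Y.

Definition P2 (x : V) : K :=
  let a := \det (x.2 0) in
  let b := polar_det (x.2 0) (x.2 1) in
  let c := polar_det (x.2 0) (x.2 2%:R) in
  let d := \det (x.2 1) in
  let e := polar_det (x.2 1) (x.2 2%:R) in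
  let f := \det (x.2 2%:R) in
  4%:R * a * d * f + b * c * e - a * e ^+ 2 - d * c ^+ 2 - f * b ^+ 2.

Definition R322 : {ffun 'I_3 -> 'M[K]_2} :=
  [ffun i : 'I_3 => [:: - delta_mx 0 0 + delta_mx 1 1; delta_mx 0 1;
                        delta_mx 1 0]`_i].

Definition Rpt : V := (delta_mx 0 2%:R, R322).

Definition nonsingular (x : V) : Prop := P1 x != 0 /\ P2 x != 0.

Definition Gorbit (x : V) : V -> Prop :=
  fun y => exists2 g, G g & y = Vact g x.

Definition nonsingular_orbits (O : V -> Prop) : Prop :=
  exists2 x, nonsingular x & O = Gorbit x.

(* The binary quadratic form q_0 u1^2 + q_1 u1 u2 + q_2 u2^2 is represented by
   the row vector of its coefficients. *)
Definition bqf_eval (q : 'rV[K]_3) (r1 r2 : K) : K :=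
  q 0 0 * r1 ^+ 2 + q 0 1 * r1 * r2 + q 0 2%:R * r2 ^+ 2.

Definition sym_mul (u v : 'cV[K]_2) : 'rV[K]_3 :=
  \row_(l < 3) [:: u 0 0 * v 0 0; u 0 0 * v 1 0 + u 1 0 * v 0 0;
                   u 1 0 * v 1 0]`_l.

Definition sym2 (g : 'M[K]_2) (q : 'rV[K]_3) : 'rV[K]_3 :=
  q 0 0 *: sym_mul (col 0 g) (col 0 g) + q 0 1 *: sym_mul (col 0 g) (col 1 g)
    + q 0 2%:R *: sym_mul (col 1 g) (col 1 g).

Definition dimV : nat := (3 + 3 * (2 * 2))%N.

Definition Vcoord (x : V) : 'rV[K]_dimV :=
  row_mx x.1 (mxvec (\matrix_(i < 3) mxvec (x.2 i))).

End Space.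

Arguments Rpt {K}.

Definition polymap (k : fieldType) : Type := 'I_3 -> {mpoly k[dimV]}.

Definition polymap_at (k K : fieldType) (iota : {rmorphism k -> K})
    (Phi : polymap k) (x : V K) : 'rV[K]_3 :=
  \row_l mmap iota (fun i => Vcoord x 0 i) (Phi l).

(* Equivariance is that of algebraic varieties over k, so it is required for
   the K-points of G and V, for every extension K of k: over a finite field k,
   the k-points alone would not suffice. *)
Definition is_Phi (k : fieldType) (Phi : polymap k) : Prop :=
  polymap_at idfun Phi Rpt = delta_mx 0 1 /\
  forall (K : fieldType) (iota : {rmorphism k -> K}) (g : grp K) (x : V K),
    G g ->
    polymap_at iota Phi (Vact g x) =
      (gt g * \det (g1 g) ^+ 2 * \det (g2 g) ^+ 2 * \det (g3 g))
        *: sym2 (g3 g) (polymap_at iota Phi x).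

Definition ext_iso (k : fieldType) (L L' : fieldExtType k) : Prop :=
  exists f : {lrmorphism L -> L'}, bijective f.

Definition Ex2 (k : fieldType) (C : fieldExtType k -> Prop) : Prop :=
  exists2 L : fieldExtType k,
    separable 1 {:L} /\ (\dim {:L} <= 2)%N & C = ext_iso L.

(* The extensions of k generated by a root [r1 : r2] of Phi(x) in the projective
   line. The field of definition of [r1 : r2] is k(r1 / r2); if r2 = 0 it is k,
   in accordance with r1 / 0 = 0 here. *)
Definition root_fields (k : fieldType) (Phi : polymap k) (x : V k)
    (L : fieldExtType k) : Prop :=
  exists r1 r2 : L,
    [/\ (r1, r2) != (0, 0),
        bqf_eval (map_mx (in_alg L) (polymap_at idfun Phi x)) r1 r2 = 0
      & <<1; r1 / r2>>%VS = fullv].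

Lemma det2E (R : comNzRingType) (M : 'M[R]_2) :
  \det M = M 0 0 * M 1 1 - M 0 1 * M 1 0.
Proof.
rewrite (expand_det_row _ 0) !big_ord_recl big_ord0 /cofactor !det_mx11 !mxE /=.
have -> : lift 0 0 = 1 :> 'I_2 by exact/val_inj.
have -> : lift 1 0 = 0 :> 'I_2 by exact/val_inj.
by rewrite !expr0 !expr1; ring.
Qed.

Lemma det3E (R : comNzRingType) (M : 'M[R]_3) : \det M =
  M 0 0 * (M 1 1 * M 2%:R 2%:R - M 1 2%:R * M 2%:R 1)
  - M 0 1 * (M 1 0 * M 2%:R 2%:R - M 1 2%:R * M 2%:R 0)
  + M 0 2%:R * (M 1 0 * M 2%:R 1 - M 1 1 * M 2%:R 0).
Proof.
pose m (i j : nat) := M (inord i) (inord j).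
have E i j : M i j = m i j by rewrite /m !inord_val.
rewrite (expand_det_row _ 0) !big_ord_recl big_ord0 /cofactor !det2E !mxE !E /=.
by rewrite /bump /= !expr0 !expr1 sqrrN expr1n; ring.
Qed.

Lemma det_lincomb3 (K : fieldType) (X Y Z : 'M[K]_2) (u v w : K) :
  \det (u *: X + v *: Y + w *: Z) =
    \det X * u ^+ 2 + polar_det X Y * u * v + polar_det X Z * u * w
    + \det Y * v ^+ 2 + polar_det Y Z * v * w + \det Z * w ^+ 2.
Proof. by rewrite /polar_det !det2E !mxE; ring. Qed.

(* Existence of Phi. The matrix M = phi_M(A, B) represents A /\ B, so that
   P1 = \det M; N = phi_N(B) spans the orthogonal of B_1, B_2, B_3 for the
   polarization of \det; Phi is - 1/2 times the quadratic form with matrix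
   M^T J N, where J is the standard symplectic matrix. *)
Section PhiFormula.
Variable R : comNzRingType.
Implicit Types (b : 'I_3 -> 'I_2 -> 'I_2 -> R) (a : 'I_3 -> R).

Definition phi_M a b j l := a 0 * b 2%:R j l - a 1 * b 1 j l + a 2%:R * b 0 j l.
Definition minor3 b (p q r : 'I_2 * 'I_2) :=
  let c i s := b i s.1 s.2 in
  c 0 p * (c 1 q * c 2%:R r - c 1 r * c 2%:R q)
  - c 0 q * (c 1 p * c 2%:R r - c 1 r * c 2%:R p)
  + c 0 r * (c 1 p * c 2%:R q - c 1 q * c 2%:R p).
Definition phi_N b (j l : 'I_2) : R :=
  if j == 0 then if l == 0 then - minor3 b (0,0) (0,1) (1,0)
                 else - minor3 b (0,0) (0,1) (1,1)
  else if l == 0 then minor3 b (0,0) (1,0) (1,1)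
       else minor3 b (0,1) (1,0) (1,1).

Definition phi_S a b j l :=
  phi_M a b 0 j * phi_N b 1 l - phi_M a b 1 j * phi_N b 0 l.
Definition phi_coef (h : R) a b (l : 'I_3) : R :=
 - h * [:: phi_S a b 0 0; phi_S a b 0 1 + phi_S a b 1 0; phi_S a b 1 1]`_l.
End PhiFormula.

Definition varA (i : 'I_3) : 'I_dimV := lshift (3 * (2 * 2)) i.
Definition varB (i : 'I_3) (j l : 'I_2) : 'I_dimV :=
  rshift 3 (mxvec_index i (mxvec_index j l)).

Definition phi (k : fieldType) : polymap k :=
  phi_coef (2%:R^-1)%:MP (fun i => 'X_(varA i)) (fun i j l => 'X_(varB i j l)).

Lemma phi_at (k K : fieldType) (iota : {rmorphism k -> K}) (x : V K) :
  polymap_at iota (@phi k) x =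
   \row_l phi_coef (2%:R^-1) (fun i => x.1 0 i) (fun i j l => x.2 i j l) l.
Proof.
set v := fun i => Vcoord x 0 i.
have Ea i : mmap iota v 'X_(varA i) = x.1 0 i.
  by rewrite mmapX mmap1U /v /Vcoord row_mxEl.
have Eb i j l : mmap iota v 'X_(varB i j l) = x.2 i j l.
  by rewrite mmapX mmap1U /v /Vcoord row_mxEr mxvecE mxE mxvecE.
have Eh : mmap iota v (2%:R^-1)%:MP = 2%:R^-1.
  rewrite mmapC; apply: (etrans (fmorphV iota _)); congr (_^-1).
  exact: (rmorph_nat iota).
apply/rowP => l; rewrite !mxE -/v /phi /phi_coef.
rewrite rmorphM rmorphN /= Eh; congr (_ * _).
have ES j m :
  mmap iota v (phi_S (fun i => 'X_(varA i)) (fun i j l => 'X_(varB i j l)) j m)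
   = phi_S (fun i => x.1 0 i) (fun i j l => x.2 i j l) j m.
  rewrite /phi_S /phi_M /phi_N /minor3 /=.
  by case: (m == 0);
    rewrite !(rmorphB, rmorphD, rmorphM, rmorphN) /= !Ea !Eb.
case: l => [] [|[|[|//]]] h /=; rewrite ?ES //.
by rewrite -!ES; exact: rmorphD.
Qed.

Section Equivariance.
Variables (K : fieldType).
Implicit Types (b : 'I_3 -> 'I_2 -> 'I_2 -> K).

Lemma ord2_ind (P : 'I_2 -> Prop) : P 0 -> P 1 -> forall i, P i.
Proof.
move=> P0 P1 [] [|[|//]] h.
  by rewrite (_ : Ordinal h = 0) //; apply/val_inj.
by rewrite (_ : Ordinal h = 1) //; apply/val_inj.
Qed.

Lemma sum_ord3 (F : 'I_3 -> K) : \sum_j F j = F 0 + F 1 + F 2%:R.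
Proof.
rewrite !big_ord_recl big_ord0 addr0 addrA.
by congr (F _ + F _ + F _); exact/val_inj.
Qed.

Lemma sum_ord2 (F : 'I_2 -> K) : \sum_j F j = F 0 + F 1.
Proof.
rewrite !big_ord_recl big_ord0 addr0.
by congr (F _ + F _); exact/val_inj.
Qed.

Lemma phi_N_g1 (g : 'M[K]_3) b j l :
 phi_N (fun i j l => \sum_s g i s * b s j l) j l = \det g * phi_N b j l.
Proof.
rewrite det3E; elim/ord2_ind: j; elim/ord2_ind: l;
  rewrite /phi_N /= /minor3 /= !sum_ord3; ring.
Qed.

Lemma phi_N_g2 (g : 'M[K]_2) b j l :
 phi_N (fun i j l => \sum_s g j s * b i s l) j l =
   \det g * \sum_s g j s * phi_N b s l.
Proof.
rewrite det2E sum_ord2; elim/ord2_ind: j; elim/ord2_ind: l;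
  rewrite /phi_N /= /minor3 /= !sum_ord2; ring.
Qed.

Lemma phi_N_g3 (g : 'M[K]_2) b j l :
 phi_N (fun i j l => \sum_s b i j s * g l s) j l =
   \det g * \sum_s phi_N b j s * g l s.
Proof.
rewrite det2E sum_ord2; elim/ord2_ind: j; elim/ord2_ind: l;
  rewrite /phi_N /= /minor3 /= !sum_ord2; ring.
Qed.

Lemma phi_M_g1 (g : 'M[K]_3) (a : 'rV[K]_3) b j l :
 phi_M (fun i => wedge2 g a 0 i) (fun i j l => \sum_s g i s * b s j l) j l =
   \det g * phi_M (fun i => a 0 i) b j l.
Proof.
rewrite det3E /phi_M !sum_ord3 /wedge2 /wedge !mxE /=; ring.
Qed.

Lemma eq_phi_N b b' j l : (forall i j l, b i j l = b' i j l) ->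
  phi_N b j l = phi_N b' j l.
Proof. by move=> E; rewrite /phi_N /minor3 /= !E. Qed.

Lemma phi_equiv (g : grp K) (x : V K) h : let x' := Vact g x in
  \row_l phi_coef h (fun i => x'.1 0 i) (fun i j l => x'.2 i j l) l =
   (gt g * \det (g1 g) ^+ 2 * \det (g2 g) ^+ 2 * \det (g3 g)) *:
     sym2 (g3 g)
       (\row_l phi_coef h (fun i => x.1 0 i) (fun i j l => x.2 i j l) l).
Proof.
move=> x'.
pose b := fun i j l => x.2 i j l; pose a := fun i => x.1 0 i.
pose b3 := fun i j l => \sum_s b i j s * g3 g l s.
pose b2 := fun i j l => \sum_s g2 g j s * b3 i s l.
pose b1 := fun i j l => \sum_s g1 g i s * b2 s j l.
have Eb i j l : x'.2 i j l = b1 i j l.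
  rewrite /x' /Vact /= ffunE summxE; apply: eq_bigr => s _.
  rewrite mxE; congr (_ * _).
  rewrite -mulmxA mxE; apply: eq_bigr => u _.
  by rewrite mxE; congr (_ * _); apply: eq_bigr => w _; rewrite mxE.
have EN j l : phi_N (fun i j l => x'.2 i j l) j l =
  \det (g1 g) * (\det (g2 g) *
    \sum_s g2 g j s * (\det (g3 g) * \sum_u phi_N b s u * g3 g l u)).
  rewrite (eq_phi_N _ _ Eb) phi_N_g1 phi_N_g2; congr (_ * (_ * _)).
  by apply: eq_bigr => s _; rewrite phi_N_g3.
have EM j l : phi_M (fun i => x'.1 0 i) (fun i j l => x'.2 i j l) j l =
  gt g * (\det (g1 g) * (\sum_s g2 g j s * \sum_u phi_M a b s u * g3 g l u)).
  transitivity (gt g * phi_M (fun i => wedge2 (g1 g) x.1 0 i) b1 j l).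
    by rewrite /phi_M !Eb /x' /Vact /= ![(_ *: _ : 'rV__) _ _]mxE; ring.
  rewrite phi_M_g1; congr (_ * (_ * _)).
  by rewrite /b2 /b3 /phi_M /a !sum_ord2; ring.
apply/rowP => l; rewrite mxE /phi_coef /phi_S !EM !EN !sum_ord2.
rewrite (det2E (g2 g)) /sym2 /sym_mul.
rewrite !mxE /phi_coef /phi_S -/a -/b -/(phi_S a b) /=.
case: l => [] [|[|[|//]]] hl /=; ring.
Qed.

End Equivariance.

Lemma phiP (K : fieldType) : (2%N \notin [pchar K]) -> is_Phi (@phi K).
Proof.
rewrite inE /= => nz2; split; last first.
  by move=> L iota g x _; rewrite !phi_at; exact: phi_equiv.
rewrite phi_at; apply/rowP => l; rewrite !mxE.
rewrite /phi_coef /phi_S /phi_M /phi_N /minor3 /Rpt /R322 !ffunE /=.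
rewrite !mxE /=.
case: l => [] [|[|[|//]]] hl /=; first ring; last ring.
by field.
Qed.

(* Main.v *)
Require Import Defs.
From HB Require Import structures.
From mathcomp Require Import all_boot all_order all_algebra all_field.
From mathcomp Require Import mpoly.
From mathcomp Require Import ring.
From Stdlib Require Import Classical.
From Stdlib Require Import FunctionalExtensionality PropExtensionality.

(* Put delta := - P1 P2. Let M = phi_M(A, B) and let N = phi_N(B) span the
   orthogonal of the B_i for the polarization of \det. Then T = M (adj N) has
   trace zero and T^2 = delta, and T is conjugate to the companion matrix of
   X^2 - delta since 2 is invertible. The corresponding change of basis carries
   the span of the B_i to sl_2, so every nonsingular x is equivalent to a normal
   form depending only on delta(x). As delta is multiplied by squares under G,
   the nonsingular orbits correspond to k^* / k^*2. Over an extension of k in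
   which delta(x) is a square, x is equivalent to R, and comparing characters
   there shows that the discriminant of Phi(x) is delta(x). A root of Phi(x)
   therefore generates k(sqrt(delta(x))), and Kummer theory for the exponent 2
   concludes. *)

Set Implicit Arguments.
Unset Strict Implicit.
Unset Printing Implicit Defensive.

Import GRing.Theory.
Local Open Scope ring_scope.

(** * The action of G, its orbits, and the relative invariants P1 and P2 *)

Section Orbits.
Variable K : fieldType.
Implicit Types (x y : V K) (g h : grp K).

Definition gmul g h : grp K :=
  Grp (g1 g *m g1 h) (g2 g *m g2 h) (g3 g *m g3 h) (gt g * gt h).

Definition ginv g : grp K :=
  Grp (invmx (g1 g)) (invmx (g2 g)) (invmx (g3 g)) (gt g)^-1.

Lemma G_mul g h : G g -> G h -> G (gmul g h).
Proof.
by case=> ? ? ? ? [*]; split; rewrite /= ?unitmx_mul ?mulf_neq0 //; apply/andP.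
Qed.

Lemma G_inv g : G g -> G (ginv g).
Proof. by case=> *; split; rewrite /= ?unitmx_inv ?invr_eq0. Qed.

Lemma ord3_ind (P : 'I_3 -> Prop) : P 0 -> P 1 -> P 2%:R -> forall i, P i.
Proof.
move=> P0 P1 P2 [] [|[|[|//]]] h.
- by rewrite (_ : Ordinal h = 0) //; apply/val_inj.
- by rewrite (_ : Ordinal h = 1) //; apply/val_inj.
- by rewrite (_ : Ordinal h = 2%:R) //; apply/val_inj.
Qed.

Lemma wedge2_mul (a b : 'M[K]_3) v : wedge2 (a *m b) v = wedge2 a (wedge2 b v).
Proof.
apply/rowP => l; elim/ord3_ind: l; rewrite /wedge2 /wedge !mxE /= !sum_ord3; ring.
Qed.

Lemma wedge2_1 (v : 'rV[K]_3) : wedge2 1%:M v = v.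
Proof.
apply/rowP => l; elim/ord3_ind: l; rewrite /wedge2 /wedge !mxE /=; ring.
Qed.

Lemma wedge2Z (a : 'M[K]_3) c v : wedge2 a (c *: v) = c *: wedge2 a v.
Proof.
apply/rowP => l; elim/ord3_ind: l; rewrite /wedge2 /wedge !mxE /=; ring.
Qed.

Lemma Vact_mul g h x : Vact (gmul g h) x = Vact g (Vact h x).
Proof.
congr (_, _); first by rewrite /= wedge2_mul wedge2Z scalerA.
apply/ffunP => i; rewrite !ffunE /=.
under [RHS]eq_bigr => j _.
  rewrite ffunE mulmx_sumr mulmx_suml scaler_sumr.
  under eq_bigr => l _ do rewrite -scalemxAr -scalemxAl scalerA.
  over.
rewrite exchange_big; apply: eq_bigr => l _ /=.
by rewrite mxE -scaler_suml trmx_mul !mulmxA.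
Qed.

Lemma Vact_1 x : Vact (Grp 1%:M 1%:M 1%:M 1) x = x.
Proof.
case: x => a b; congr (_, _); first by rewrite /= scale1r wedge2_1.
apply/ffunP => i; rewrite ffunE (bigD1 i) //= big1 => [|j ne].
  by rewrite mxE eqxx scale1r trmx1 mul1mx mulmx1 addr0.
by rewrite mxE eq_sym (negPf ne) scale0r.
Qed.

Lemma Vact_inv g x : G g -> Vact (ginv g) (Vact g x) = x.
Proof.
by case=> *; rewrite -Vact_mul /gmul /= !mulVmx // mulVf // Vact_1.
Qed.

Lemma Gorbit_refl x : Gorbit x x.
Proof.
exists (Grp 1%:M 1%:M 1%:M 1); last by rewrite Vact_1.
by split; rewrite ?unitmx1 ?oner_eq0.
Qed.

Lemma Gorbit_sym x y : Gorbit x y -> Gorbit y x.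
Proof. by case=> g Gg ->; exists (ginv g); [exact: G_inv | rewrite Vact_inv]. Qed.

Lemma Gorbit_trans x y z : Gorbit x y -> Gorbit y z -> Gorbit x z.
Proof.
case=> g Gg -> [h Gh ->]; exists (gmul h g); first exact: G_mul.
by rewrite Vact_mul.
Qed.

(* The matrix of A /\ B, as in phi_M; P1 is its determinant. *)
Definition phi_mx x : 'M[K]_2 :=
  x.1 0 0 *: x.2 2%:R - x.1 0 1 *: x.2 1 + x.1 0 2%:R *: x.2 0.

(** A /\ B lies in the third exterior power of the 3-space tensored with M_2, and [g1 g] acts on the
    first factor by its determinant. *)
Lemma phi_mx_Vact g x :
  phi_mx (Vact g x) = (gt g * \det (g1 g)) *: (g2 g *m phi_mx x *m (g3 g)^T).
Proof.
pose B i := g2 g *m x.2 i *m (g3 g)^T.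
have -> : g2 g *m phi_mx x *m (g3 g)^T =
    x.1 0 0 *: B 2%:R - x.1 0 1 *: B 1 + x.1 0 2%:R *: B 0.
  rewrite /phi_mx !(mulmxDl, mulmxDr, mulmxN, mulNmx).
  by rewrite -!(scalemxAr, scalemxAl).
apply/matrixP => j l; have E i : (Vact g x).2 i j l = \sum_s g1 g i s * B s j l.
  by rewrite ffunE summxE; apply: eq_bigr => s _; rewrite mxE.
move: B E => B E.
transitivity (gt g * (phi_M (fun i => wedge2 (g1 g) x.1 0 i)
   (fun i j l => \sum_s g1 g i s * B s j l) j l)).
  have Ea i : (Vact g x).1 0 i = gt g * wedge2 (g1 g) x.1 0 i by rewrite mxE.
  by rewrite /phi_mx /phi_M -!E !Ea ![(_ + _ : 'M__) _ _]mxE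
    ![(- _ : 'M__) _ _]mxE ![(_ *: _ : 'M__) _ _]mxE; ring.
by rewrite phi_M_g1 /phi_M !mxE; ring.
Qed.

Lemma P1_Vact g x :
  P1 (Vact g x) = (gt g * \det (g1 g)) ^+ 2 * (\det (g2 g) * \det (g3 g)) * P1 x.
Proof.
rewrite /P1 -/(phi_mx _) phi_mx_Vact detZ !det_mulmx det_tr -/(phi_mx x); ring.
Qed.

(** P2 is the half-discriminant of the ternary form u -> \det (\sum_i u_i B_i), and [g] substitutes
    variables in that form. Singular [g] are included: [normal_form] uses this to prove a coordinate
    matrix invertible. *)
Lemma P2_lincomb (x y : V K) (g : 'M[K]_3) :
  (forall i, y.2 i = \sum_j g i j *: x.2 j) -> P2 y = \det g ^+ 2 * P2 x.
Proof.
move=> E; have S i : y.2 i = g i 0 *: x.2 0 + g i 1 *: x.2 1 + g i 2%:R *: x.2 2%:R.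
  rewrite E !big_ord_recl big_ord0 addr0 addrA.
  have -> : lift ord0 ord0 = 1 :> 'I_3 by exact/val_inj.
  by have -> : lift ord0 (lift ord0 ord0) = 2%:R :> 'I_3 by exact/val_inj.
have Q i j : polar_det (y.2 i) (y.2 j) = 
  \det ((g i 0 + g j 0) *: x.2 0 + (g i 1 + g j 1) *: x.2 1 +
        (g i 2%:R + g j 2%:R) *: x.2 2%:R) - \det (y.2 i) - \det (y.2 j).
  rewrite /polar_det; congr (\det _ - _ - _).
  by apply/matrixP => r s; rewrite !S !mxE; ring.
rewrite /P2 !Q !S !det_lincomb3 det3E.
set a := \det (x.2 0); set d := \det (x.2 1); set f := \det (x.2 2%:R).
move: (polar_det _ _) (polar_det _ _) (polar_det _ _) => b c e.
move: a d f => a d f.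
ring.
Qed.

Lemma P2_Vact g x :
  P2 (Vact g x) = \det (g1 g) ^+ 2 * (\det (g2 g) * \det (g3 g)) ^+ 3 * P2 x.
Proof.
(* Here only g_2 and g_3 act on B, which rescales all values of \det by one factor; P2 is cubic in
   those values. [P2_lincomb] accounts for g_1. *)
pose y : V K := (x.1, [ffun i => g2 g *m x.2 i *m (g3 g)^T]).
rewrite (@P2_lincomb y _ (g1 g)); last first.
  by move=> i; rewrite ffunE; apply: eq_bigr => j _; rewrite ffunE.
have D i : \det (y.2 i) = \det (g2 g) * \det (g3 g) * \det (x.2 i).
  by rewrite ffunE !det_mulmx det_tr; ring.
have Q i j : polar_det (y.2 i) (y.2 j) =
    \det (g2 g) * \det (g3 g) * polar_det (x.2 i) (x.2 j).
  rewrite /polar_det !D !ffunE -mulmxDl -mulmxDr !det_mulmx det_tr; ring.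
by rewrite /P2 !Q !D; ring.
Qed.

Definition delta x : K := - (P1 x * P2 x).

Lemma delta_neq0 x : nonsingular x -> delta x != 0.
Proof. by case=> ? ?; rewrite oppr_eq0 mulf_neq0. Qed.

Lemma delta_Vact g x : delta (Vact g x) =
  (gt g * \det (g1 g) ^+ 2 * \det (g2 g) ^+ 2 * \det (g3 g) ^+ 2) ^+ 2 * delta x.
Proof. rewrite /delta P1_Vact P2_Vact; ring. Qed.

Definition ortho_mx (x : V K) : 'M[K]_2 :=
  \matrix_(j, l) phi_N (fun i j l => x.2 i j l) j l.

(** As for a cross product: the polarization of \det is unimodular on M_2, so over the integers the
    Gram determinant 2 P2 of the B_i equals that of N, which is 2 \det N. *)
Lemma det_ortho_mx x : \det (ortho_mx x) = P2 x.
Proof.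
rewrite /P2 /polar_det !det2E !mxE /phi_N /minor3 /=; ring.
Qed.

End Orbits.

Section NormalForm.
Variable K : fieldType.
Implicit Types (x y : V K) (g h : grp K).

Lemma mx2P (M N : 'M[K]_2) : M 0 0 = N 0 0 -> M 0 1 = N 0 1 ->
  M 1 0 = N 1 0 -> M 1 1 = N 1 1 -> M = N.
Proof.
by move=> *; apply/matrixP => i j; elim/ord2_ind: i; elim/ord2_ind: j.
Qed.

Lemma mulmx2E (M N : 'M[K]_2) i j : (M *m N) i j = M i 0 * N 0 j + M i 1 * N 1 j.
Proof. by rewrite mxE sum_ord2. Qed.

(** The adjugate, with explicit entries so that [ring] can settle identities about it. *)
Definition adj2 (M : 'M[K]_2) : 'M[K]_2 :=
  \matrix_(i, j) if i == 0 then if j == 0 then M 1 1 else - M 0 1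
                 else if j == 0 then - M 1 0 else M 0 0.

Lemma det_adj2 M : \det (adj2 M) = \det M.
Proof. by rewrite !det2E !mxE /=; ring. Qed.

Definition companion2 (d : K) : 'M[K]_2 :=
  \matrix_(i, j) if i == 0 then if j == 0 then 0 else d
                 else if j == 0 then 1 else 0.

(** For B = [R322], A /\ B is a_1 E21 - a_2 E12 + a_3 (E22 - E11); A is chosen to make it
    [companion2 d]. *)
Definition normal_pt (d : K) : V K :=
  (\row_(l < 3) [:: 1; - d; 0]`_l, R322 K).

(** By Cayley-Hamilton T^2 = - \det T, so any w independent of T w gives the change of basis. One of
    (1, 0), (0, 1), (1, 1) is such a w: if the first two are eigenvectors, then T = diag(t, -t) with
    2 t nonzero. *)
Lemma trace0_companion (T : 'M[K]_2) : 2%:R != 0 :> K -> T 0 0 + T 1 1 = 0 ->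
  \det T != 0 -> exists2 p, p \in unitmx & T *m p = p *m companion2 (- \det T).
Proof.
move=> nz2 trT nzT.
have E : T 1 1 = - T 0 0 by apply/eqP; rewrite -addr_eq0 addrC trT.
(* p u v has the columns w and T w, where w = (u, v). *)
pose p (u v : K) : 'M[K]_2 := \matrix_(i, j)
  if i == 0 then if j == 0 then u else T 0 0 * u + T 0 1 * v
  else if j == 0 then v else T 1 0 * u + T 1 1 * v.
have pP u v : T *m p u v = p u v *m companion2 (- \det T).
  by apply: mx2P; rewrite !mulmx2E det2E !mxE /= ?E; ring.
(* The quadratic form in the premise is the determinant of [p u v]. *)
have unitp u v : T 1 0 * u ^+ 2 - 2%:R * T 0 0 * u * v - T 0 1 * v ^+ 2 != 0 ->
    exists2 p, p \in unitmx & T *m p = p *m companion2 (- \det T).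
  move=> nz; exists (p u v) => //; rewrite unitmxE unitfE det2E !mxE /= E.
  by apply: contraNneq nz => <-; apply/eqP; ring.
have [T10|?] := eqVneq (T 1 0) 0; last first.
  by apply: (unitp 1 0); rewrite [X in X != 0](_ : _ = T 1 0) //; ring.
have [T01|?] := eqVneq (T 0 1) 0; last first.
  by apply: (unitp 0 1); rewrite [X in X != 0](_ : _ = - T 0 1) ?oppr_eq0 //; ring.
apply: (unitp 1 1); rewrite T10 T01.
rewrite [X in X != 0](_ : _ = - (2%:R * T 0 0)) ?oppr_eq0; last by ring.
rewrite mulf_neq0 //; apply: contraNneq nzT => T00.
by rewrite det2E T00 T10 !(mul0r, mulr0) subr0.
Qed.

(** Coordinates of the B_i in the basis [R322] of sl_2; its first vector is - E11 + E22, hence the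
    entry at 1 1. *)
Definition sl2_coord (C : V K) : 'M[K]_3 := \matrix_(i, j)
  [:: C.2 i 1 1; C.2 i 0 1; C.2 i 1 0]`_j.

Lemma sl2_coordP x i : x.2 i 0 0 + x.2 i 1 1 = 0 ->
  x.2 i = \sum_j sl2_coord x i j *: R322 K j.
Proof.
move=> tr0; have E : x.2 i 0 0 = - x.2 i 1 1.
  by rewrite -[LHS](addrK (x.2 i 1 1)) tr0 sub0r.
apply: mx2P; rewrite summxE sum_ord3 !mxE !ffunE /= !mxE /= ?E; ring.
Qed.

(** The trace of X (adj Y) is the polarization of \det at (X, Y). The entries of N are signed
    maximal minors of the 3 x 4 matrix of the B_i, so the trace expands a 4 x 4 determinant with a
    repeated row. *)
Lemma ortho_mxP x i :
  (x.2 i *m adj2 (ortho_mx x)) 0 0 + (x.2 i *m adj2 (ortho_mx x)) 1 1 = 0.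
Proof.
elim/ord3_ind: i; rewrite !mulmx2E !mxE /= /phi_N /minor3 /=; ring.
Qed.

Lemma P2_normal_pt d : P2 (normal_pt d) = 1.
Proof.
rewrite -det_ortho_mx det2E !mxE /phi_N /minor3 /= !ffunE /= !mxE /=; ring.
Qed.

Lemma phi_mx_normal_pt d : phi_mx (normal_pt d) = companion2 d.
Proof.
by apply: mx2P; rewrite /phi_mx /normal_pt /= !ffunE /= !mxE /=; ring.
Qed.

(** The members of [R322] are linearly independent; once B is normalized, A is thus recovered from A
    /\ B. *)
Lemma phi_mx_R322_inj (a a' : 'rV[K]_3) :
  phi_mx (a, R322 K) = phi_mx (a', R322 K) -> a = a'.
Proof.
move=> E; apply/rowP => l; move: (congr1 (fun M : 'M_2 => M 1 0) E).
move: (congr1 (fun M : 'M_2 => M 0 1) E) (congr1 (fun M : 'M_2 => M 1 1) E).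
rewrite /phi_mx /= !ffunE /= !mxE /=.
rewrite !(mulr0, mulr1, addr0, oppr0, add0r, subr0, sub0r).
by move=> /oppr_inj ? ? ?; elim/ord3_ind: l.
Qed.

Lemma trace_conj (p M : 'M[K]_2) : p \in unitmx ->
  (invmx p *m M *m p) 0 0 + (invmx p *m M *m p) 1 1 = M 0 0 + M 1 1.
Proof.
move=> up; rewrite -!(sum_ord2 (fun i => _ i i)) -!/(mxtrace _).
by rewrite mxtrace_mulC mulmxA mulmxV // mul1mx.
Qed.

Lemma nonsingular_Vact g x : G g -> nonsingular x -> nonsingular (Vact g x).
Proof.
case; rewrite !unitmxE !unitfE => d1 d2 d3 nt [p1 p2].
by split; rewrite ?P1_Vact ?P2_Vact !mulf_neq0 ?expf_neq0 ?mulf_neq0.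
Qed.

Lemma normal_form x : 2%:R != 0 :> K -> nonsingular x ->
  Gorbit x (normal_pt (delta x)).
Proof.
move=> nz2 nsx; have [nzP1 nzP2] := nsx.
set N := adj2 (ortho_mx x); pose T := phi_mx x *m N.
have dN : \det N = P2 x by rewrite det_adj2 det_ortho_mx.
have dT : - \det T = delta x by rewrite det_mulmx dN.
(* A /\ B is a linear combination of the B_i, which are orthogonal to N. *)
have trT : T 0 0 + T 1 1 = 0.
  rewrite -(sum_ord2 (fun i => T i i)) -/(mxtrace T) /T /phi_mx.
  rewrite !mulmxDl mulNmx -!scalemxAl !linearD /= linearN /= !mxtraceZ.
  have t i : \tr (x.2 i *m N) = 0 by rewrite /mxtrace sum_ord2 ortho_mxP.
  by rewrite !t !mulr0 subr0 addr0.
have [|p up Tp] := trace0_companion nz2 trT.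
  by rewrite -oppr_eq0 dT delta_neq0.
rewrite dT in Tp.
(* g moves the B_i into sl_2 and T to its companion matrix; g' below moves the
   resulting basis of sl_2 to R322. *)
pose g := Grp 1%:M (invmx p) (N *m p)^T 1.
have Gg : G g.
  split; rewrite ?unitmx1 ?unitmx_inv ?oner_eq0 //=.
  by rewrite unitmx_tr unitmx_mul up andbT unitmxE dN unitfE.
pose y := Vact g x.
have y2 i : y.2 i = invmx p *m (x.2 i *m N) *m p.
  rewrite ffunE (bigD1 i) //= big1 => [|j ne].
    by rewrite mxE eqxx scale1r addr0 trmxK !mulmxA.
  by rewrite mxE eq_sym (negPf ne) scale0r.
have cy : phi_mx y = companion2 (delta x).
  rewrite phi_mx_Vact /= trmxK det1 mul1r scale1r mulmxA -(mulmxA _ _ N) -/T.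
  by rewrite -mulmxA Tp mulmxA mulVmx // mul1mx.
pose h := sl2_coord y.
have hP i : y.2 i = \sum_j h i j *: R322 K j.
  by apply: sl2_coordP; rewrite y2 trace_conj // ortho_mxP.
have uh : h \in unitmx.
  have [_] := nonsingular_Vact Gg nsx; rewrite unitmxE unitfE.
  apply: contraNneq => dh.
  (* P2 sees only B, so [normal_pt 0] stands for any point with B = [R322]. *)
  have -> : P2 y = \det h ^+ 2 * P2 (normal_pt 0) by apply: P2_lincomb.
  by rewrite dh expr0n mul0r.
(* The scalar [\det h] cancels the determinant of [invmx h], so that A /\ B remains the companion
   matrix. *)
pose g' := Grp (invmx h) 1%:M 1%:M (\det h).
have Gg' : G g'.
  by split=> /=; rewrite ?unitmx_inv ?unitmx1 // -unitfE -unitmxE.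
suff -> : normal_pt (delta x) = Vact g' y.
  by apply: Gorbit_trans (ex_intro2 _ _ g' Gg' erefl); exists g.
have E2 : (Vact g' y).2 = R322 K.
  apply/ffunP => i; rewrite ffunE /= trmx1.
  under eq_bigr => j _ do rewrite mul1mx mulmx1 hP scaler_sumr.
  rewrite exchange_big.
  transitivity (\sum_l (invmx h *m h) i l *: R322 K l).
    apply: eq_bigr => l _; rewrite mxE scaler_suml.
    by apply: eq_bigr => j _; rewrite scalerA.
  rewrite mulVmx // (bigD1 i) //= big1 => [|l ne].
    by rewrite mxE eqxx scale1r addr0.
  by rewrite mxE eq_sym (negPf ne) scale0r.
rewrite [RHS]surjective_pairing E2; congr (_, _); apply: phi_mx_R322_inj.
rewrite -{2}E2 -surjective_pairing -/(normal_pt _) phi_mx_normal_pt.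
rewrite phi_mx_Vact /= cy.
by rewrite det_inv mulfV -?unitfE -?unitmxE // scale1r trmx1 mul1mx mulmx1.
Qed.

Lemma delta_normal_pt d : delta (normal_pt d) = d.
Proof.
rewrite /delta P2_normal_pt mulr1 /P1 -/(phi_mx _) phi_mx_normal_pt det2E.
by rewrite !mxE /=; ring.
Qed.

Lemma nonsingular_normal_pt d : d != 0 -> nonsingular (normal_pt d).
Proof.
move=> nz; split; rewrite ?P2_normal_pt ?oner_eq0 //.
by apply: contraNneq nz => E; rewrite -(delta_normal_pt d) /delta E mul0r oppr0.
Qed.

(** Acting on x by the scalar [c] of GL_1 equalizes the two values of [delta]; both points then have
    the same normal form. *)
Lemma Gorbit_delta x y c : 2%:R != 0 :> K -> nonsingular x -> nonsingular y ->
  c != 0 -> delta y = c ^+ 2 * delta x -> Gorbit x y.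
Proof.
move=> nz2 nsx nsy nzc E.
pose g : grp K := Grp 1%:M 1%:M 1%:M c.
have Gg : G g by split; rewrite /= ?unitmx1.
have Ed : delta (Vact g x) = delta y.
  by rewrite delta_Vact E /= !det1 !expr1n !mulr1.
have xgx : Gorbit x (Vact g x) by exists g.
apply: (Gorbit_trans xgx (Gorbit_trans _ (Gorbit_sym (normal_form nz2 nsy)))).
by rewrite -Ed; apply: normal_form => //; exact: nonsingular_Vact.
Qed.

Lemma delta_Rpt : delta (@Rpt K) = 1.
Proof.
rewrite /delta -det_ortho_mx /P1 !det2E !mxE /phi_N /minor3 /= !ffunE /=.
by rewrite !mxE /=; ring.
Qed.

Lemma nonsingular_delta x : delta x != 0 -> nonsingular x.
Proof. by rewrite oppr_eq0 mulf_eq0 negb_or => /andP. Qed.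

End NormalForm.

(** * Simple extensions of k and isomorphisms between them *)

Section SimpleExtensions.
Variable k : fieldType.
Implicit Types (L : fieldExtType k) (p q : {poly k}).

Notation ev s p := (map_poly (in_alg _) p).[s].

(** The equality is boolean so that [xchoose] can select the polynomial. *)
Lemma gen_ev L (s y : L) : <<1; s>>%VS = fullv -> exists p, ev s p == y.
Proof.
move=> gen; have /Fadjoin_polyP[_ /polyOver1P[p ->] ->] : y \in <<1; s>>%VS.
  by rewrite gen memvf.
by exists p.
Qed.

(** Both fields are the quotient of k[X] by the same ideal, the kernel of evaluation at the
    generator. *)
Lemma ext_iso_gen L L' (s : L) (s' : L') :
    <<1; s>>%VS = fullv -> <<1; s'>>%VS = fullv ->
    (forall p, (ev s p == 0) = (ev s' p == 0)) -> ext_iso L L'.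
Proof.
move=> gen gen' ann.
have ann2 p q : (ev s p == ev s q) = (ev s' p == ev s' q).
  by rewrite -subr_eq0 -[RHS]subr_eq0 -!hornerN -!hornerD -!rmorphB ann.
pose f y := ev s' (xchoose (gen_ev y gen)).
pose g y := ev s (xchoose (gen_ev y gen')).
have fE p : f (ev s p) = ev s' p.
  by apply/eqP; rewrite -ann2; exact: (xchooseP (gen_ev (ev s p) gen)).
have gE p : g (ev s' p) = ev s p.
  by apply/eqP; rewrite ann2; exact: (xchooseP (gen_ev (ev s' p) gen')).
have fD : zmod_morphism f.
  move=> y z.
  have /eqP <- := xchooseP (gen_ev y gen).
  have /eqP <- := xchooseP (gen_ev z gen).
  by rewrite -hornerN -hornerD -rmorphB !fE rmorphB hornerD hornerN.
have fM : monoid_morphism f.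
  split=> [|y z].
    have <- : ev s 1 = 1 by rewrite rmorph1 hornerC.
    by rewrite fE rmorph1 hornerC.
  have /eqP <- := xchooseP (gen_ev y gen).
  have /eqP <- := xchooseP (gen_ev z gen).
  by rewrite -hornerM -rmorphM !fE rmorphM hornerM.
have fZ : scalable f.
  move=> a y; have /eqP <- := xchooseP (gen_ev y gen).
  have evZ L0 (t : L0) q : a *: ev t q = ev t (a *: q).
    by rewrite map_polyZ hornerZ mulr_algl.
  by rewrite evZ !fE evZ.
pose fL : {lrmorphism L -> L'} := HB.pack f
  (GRing.isZmodMorphism.Build L L' f fD) (GRing.isMonoidMorphism.Build L L' f fM)
  (GRing.isScalable.Build k L L' *:%R f fZ).
exists fL; exists g => y.
  by have /eqP <- := xchooseP (gen_ev y gen); rewrite [fL _]fE gE.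
by have /eqP <- := xchooseP (gen_ev y gen'); rewrite gE [fL _]fE.
Qed.

Lemma ext_iso_gen_image L L' (f : {lrmorphism L -> L'}) (s : L) :
  bijective f -> <<1; s>>%VS = fullv -> <<1; f s>>%VS = fullv.
Proof.
case=> g fK gK gen; apply/vspaceP => y; rewrite memvf -(gK y).
have [p /eqP <-] := gen_ev (g y) gen.
rewrite -horner_map -map_poly_comp; apply: mempx_Fadjoin.
apply/polyOver1P; exists p; apply: eq_map_poly => a /=.
by rewrite linearZ /= rmorph1.
Qed.

End SimpleExtensions.

(** * Extensions of degree at most 2 and square classes *)

Section SquareRoots.
Variable k : fieldType.
Hypothesis nz2 : 2%:R != 0 :> k.
Implicit Types (L : fieldExtType k) (p q : {poly k}) (d : k).

Notation ev s p := (map_poly (in_alg _) p).[s].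

(** If d is a square in k, these are the extensions of degree 1. *)
Definition sqrt_fields d L :=
  exists2 s : L, s ^+ 2 = d%:A & <<1; s>>%VS = fullv.

Lemma in_alg1v L (s : L) : s \in 1%VS -> exists a : k, s = a%:A.
Proof. by case/vlineP => a ->; exists a. Qed.

Lemma alg_in1v L a : a%:A \in (1%VS : {vspace L}).
Proof. by rewrite rpredZ ?memv_line. Qed.

Lemma alg_inj L (a b : k) : a%:A = b%:A :> L -> a = b.
Proof. exact: (fmorph_inj (in_alg L)). Qed.

Lemma algM L (a b : k) : (a * b)%:A = a%:A * b%:A :> L.
Proof. exact: (rmorphM (in_alg L)). Qed.

Lemma algX L (a : k) n : (a ^+ n)%:A = a%:A ^+ n :> L.
Proof. exact: (rmorphXn (in_alg L)). Qed.

Lemma mem1v_gen L (s : L) : <<1; s>>%VS = fullv -> s \in 1%VS ->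
  forall t : L, t \in 1%VS.
Proof. by move=> gen /Fadjoin_idP s1 t; rewrite -s1 gen memvf. Qed.

Lemma size_Xsqr_subC d : size ('X^2 - d%:P) = 3%N.
Proof. by rewrite size_XnsubC. Qed.

Lemma sqrt_fields_exists d : exists L, sqrt_fields d L.
Proof.
have [[e Ee]|irr] := classic (exists e, e ^+ 2 = d).
  exists (k^o : fieldExtType k); exists (e : k^o).
    by rewrite /GRing.scale /= mulr1 -Ee.
  apply/eqP; rewrite eqEdim subvf dimvf; exact: adim_gt0.
have sz := size_Xsqr_subC d.
have [|L _ [s Rs gen]] := @irredp_FAdjoin k ('X^2 - d%:P).
  apply: cubic_irreducible => [|x]; first by rewrite sz.
  apply/negP; rewrite /root !hornerE subr_eq0 => /eqP Ex; apply: irr.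
  by exists x.
exists L, s => //; move: Rs.
by rewrite /root rmorphB /= map_polyXn map_polyC /= !hornerE subr_eq0 => /eqP.
Qed.

Lemma ev_sqrt L (s : L) d p : s ^+ 2 = d%:A ->
  ev s p = ((p %% ('X^2 - d%:P))`_0)%:A + ((p %% ('X^2 - d%:P))`_1)%:A * s.
Proof.
move=> Es; rewrite {1}(divp_eq p ('X^2 - d%:P)) rmorphD rmorphM /= hornerD hornerM.
rewrite rmorphB /= map_polyXn map_polyC /= !hornerE Es subrr mulr0 add0r.
rewrite (@horner_coef_wide _ 2); last first.
  by rewrite size_map_poly -ltnS -(size_Xsqr_subC d) ltn_modp -size_poly_gt0 size_Xsqr_subC.
by rewrite big_ord_recl big_ord1 !coef_map expr0 mulr1 expr1.
Qed.

(** It suffices that the generators satisfy the same polynomials. If s is outside k, so is s', and a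
    polynomial vanishes at either exactly when its remainder modulo X^2 - d is zero. *)
Lemma sqrt_fields_iso d L L' :
  sqrt_fields d L -> sqrt_fields d L' -> ext_iso L L'.
Proof.
case=> s Es gen [s' Es' gen'].
have key (c : k) L0 (t : L0) : t ^+ 2 = d%:A -> t = c%:A -> d = c ^+ 2.
  by move=> Et E; apply: (@alg_inj L0); rewrite algX -E.
have [/in_alg1v[c Ec]|sN1] := boolP (s \in 1%VS).
  have dc := key _ _ _ Es Ec.
  have : (s' == c%:A) || (s' == - c%:A) by rewrite -eqf_sqr Es' dc algX.
  move=> Es'c.
  (* As s' may be -c, it is traded for c, which generates L' as well. *)
  have [t [Et gt]] : exists t : L', t = c%:A /\ <<1; t>>%VS = fullv.
    exists c%:A; split=> //; rewrite -gen'; symmetry.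
    have s'1 : s' \in 1%VS.
      by case/orP: Es'c => /eqP ->; rewrite ?rpredN alg_in1v.
    by rewrite (Fadjoin_idP s'1) (Fadjoin_idP (alg_in1v _ c)).
  apply: (ext_iso_gen gen gt) => p; rewrite Ec Et !horner_map /=.
  by rewrite !scaler_eq0 !oner_eq0.
apply: (ext_iso_gen gen gen') => p; rewrite (ev_sqrt _ Es) (ev_sqrt _ Es').
have s'N1 : s' \notin 1%VS.
  apply: contra sN1 => /in_alg1v[c Ec]; have dc := key _ _ _ Es' Ec.
  have : (s == c%:A) || (s == - c%:A) by rewrite -eqf_sqr Es dc algX.
  by case/orP => /eqP ->; rewrite ?rpredN alg_in1v.
have aux L0 (t : L0) (a b : k) : t \notin 1%VS ->
    (a%:A + b%:A * t == 0) = (a == 0) && (b == 0).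
  move=> tN1; apply/eqP/andP => [E|[/eqP-> /eqP->]]; last first.
    by rewrite !scale0r mul0r addr0.
  have b0 : b == 0.
    apply: contraNT tN1 => nzb; have -> : t = (- (b^-1 * a))%:A.
      rewrite scaleNr -scalerA -scalerN; apply: (canRL (scalerK nzb)).
      by rewrite -(mulr_algl b); apply/eqP; rewrite -addr_eq0 addrC; apply/eqP.
    exact: alg_in1v.
  split=> //; move: E; rewrite (eqP b0) scale0r mul0r addr0 => /eqP.
  by rewrite scaler_eq0 oner_eq0 orbF.
by rewrite !aux.
Qed.

Lemma ext_iso_sqrt d L L' : ext_iso L L' -> sqrt_fields d L -> sqrt_fields d L'.
Proof.
case=> f fB [s Es gen]; exists (f s); last exact: ext_iso_gen_image.
by rewrite -rmorphXn Es /= linearZ /= rmorph1.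
Qed.

(** X^2 - d has the roots s and -s, distinct because 2 s is nonzero, and the minimal polynomial of s
    divides it. *)
Lemma sqrt_fields_Ex2 d L : d != 0 -> sqrt_fields d L ->
  separable 1 {:L} /\ (\dim {:L} <= 2)%N.
Proof.
move=> nzd [s Es gen]; pose p := map_poly (in_alg L) ('X^2 - d%:P).
have Dp : p = \prod_(x <- [:: s; - s]) ('X - x%:P).
  rewrite /p rmorphB /= map_polyXn map_polyC /= -Es rmorphXn /=.
  by rewrite !big_cons big_nil rmorphN; ring.
have Rp : root p s by rewrite Dp root_prod_XsubC mem_head.
have Op : p \is a polyOver 1%VS by apply/polyOver1P; exists ('X^2 - d%:P).
split; rewrite -gen.
  rewrite -adjoin_separable_eq; apply/separable_elementP; exists p; split=> //.
  rewrite Dp separable_prod_XsubC /= inE andbT -subr_eq0 opprK -mulr2n -mulr_natl.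
  rewrite mulf_eq0 -(rmorph_nat (in_alg L)) fmorph_eq0 (negPf nz2) /=.
  by rewrite -sqrf_eq0 Es scaler_eq0 (negPf nzd) oner_eq0.
(* Degrees are compared through sizes: 2 becomes [3.-1], where 3 is the size of X^2 - d. *)
rewrite -[X in (_ <= X)%N]/(3.-1) -(size_Xsqr_subC d) -(size_map_poly (in_alg L)).
rewrite dim_Fadjoin dimv1 muln1 -ltnS -size_minPoly.
rewrite prednK ?size_map_poly ?size_Xsqr_subC // -(size_Xsqr_subC d).
rewrite -(size_map_poly (in_alg L)).
apply: dvdp_leq; last exact: minPoly_dvdp.
by rewrite -size_poly_gt0 size_map_poly size_Xsqr_subC.
Qed.

(** In degree 1, d = 1 serves. In degree 2, complete the square in the minimal polynomial of some z
    outside k; d is its discriminant. *)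
Lemma Ex2_sqrt L : (\dim {:L} <= 2)%N -> exists2 d, d != 0 & sqrt_fields d L.
Proof.
move=> dL.
have [full1|] := boolP (fullv <= (1%VS : {vspace L}))%VS.
  exists 1; first exact: oner_neq0.
  exists 1; first by rewrite expr1n scale1r.
  apply/eqP; rewrite eqEsubv subvf (subv_trans full1) //.
  by rewrite -[X in (X <= _)%VS](Fadjoin_idP (mem1v _)).
case/subvPn => z _ zN1.
have dz : adjoin_degree 1 z = 2%N.
  apply/eqP; rewrite eqn_leq; apply/andP; split.
    have := dim_Fadjoin 1 z; rewrite dimv1 muln1 => <-.
    by rewrite (leq_trans _ dL) // dimvS ?subvf.
  by rewrite ltn_neqAle eq_sym adjoin_deg_eq1 zN1.
have genz : <<1; z>>%VS = fullv.
  apply/eqP; rewrite eqEdim subvf dim_Fadjoin dz dimv1 muln1.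
  exact: dL.
have /polyOver1P[p Ep] := minPolyOver 1 z.
have sp : size p = 3%N by rewrite -(size_map_poly (in_alg L)) -Ep size_minPoly dz.
have mp : p`_2 = 1.
  have := monic_minPoly 1 z; rewrite Ep monicE /lead_coef size_map_poly sp coef_map.
  by move/eqP => /= E; apply: (@alg_inj L); rewrite E scale1r.
have Ez : (p`_0)%:A + (p`_1)%:A * z + z ^+ 2 = 0.
  have := minPolyxx 1 z; rewrite Ep (@horner_coef_wide _ 3) ?size_map_poly ?sp //.
  rewrite !big_ord_recl big_ord0 !coef_map /= mp scale1r mul1r expr0 mulr1 addr0.
  by rewrite expr1 addrA.
pose s := 2%:R%:A * z + (p`_1)%:A.
pose d := p`_1 ^+ 2 - 4%:R * p`_0.
have nz2L : (2%:R)%:A != 0 :> L by rewrite scaler_eq0 negb_or nz2 oner_neq0.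
have Es : s ^+ 2 = d%:A.
  rewrite /s /d scalerBl algX algM.
  have -> : (2%:R)%:A = 2%:R :> L by exact: (rmorph_nat (in_alg L)).
  have -> : (4%:R)%:A = 4%:R :> L by exact: (rmorph_nat (in_alg L)).
  have -> : (p`_0)%:A = - ((p`_1)%:A * z + z ^+ 2).
    by apply/eqP; rewrite -addr_eq0 addrA; apply/eqP.
  ring.
have zs : z \in <<1; s>>%VS.
  have -> : z = (2%:R)%:A^-1 * (s - (p`_1)%:A) by rewrite /s addrK mulKf.
  rewrite rpredM ?rpredV ?rpredB ?memv_adjoin //; apply: subvP_adjoin;
    exact: alg_in1v.
have gens : <<1; s>>%VS = fullv.
  apply/eqP; rewrite eqEsubv subvf -genz; apply/FadjoinP; split=> //.
  exact: subv_adjoin.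
exists d; last by exists s.
(* If d were 0, then s = 0, and z would lie in k. *)
apply: contra zN1 => /eqP d0; move: Es; rewrite d0 scale0r => /eqP.
rewrite expf_eq0 /= => /eqP s0.
by have := zs; rewrite s0 (Fadjoin_idP (mem0v _)).
Qed.

(** For s outside k, squaring s' = a + b s gives 2 a b s in k, hence a b = 0. As s' is outside k
    too, b is nonzero, so a = 0 and d' = b^2 d. *)
Lemma sqrt_fields_square d d' L : d != 0 -> d' != 0 ->
  sqrt_fields d L -> sqrt_fields d' L -> exists2 c, c != 0 & d' = c ^+ 2 * d.
Proof.
move=> nzd nzd' [s Es gen] [s' Es' gen'].
suff [c Ec] : exists c, d' = c ^+ 2 * d.
  by exists c => //; apply: contraNneq nzd' => c0; rewrite Ec c0 expr0n mul0r.
have [s1|sN1] := boolP (s \in 1%VS).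
  have [[c Ec] [c' Ec']] := (in_alg1v s1, in_alg1v (mem1v_gen gen s1 s')).
  have dc : d = c ^+ 2 by apply: (@alg_inj L); rewrite algX -Ec.
  have dc' : d' = c' ^+ 2 by apply: (@alg_inj L); rewrite algX -Ec'.
  exists (c' / c); rewrite dc dc' expr_div_n mulfVK //.
  by rewrite -dc.
have s'N1 : s' \notin 1%VS by apply: contra sN1 => s1; exact: (mem1v_gen gen').
have [p] := gen_ev s' gen; rewrite (ev_sqrt _ Es).
set a := (_`_0); set b := (_`_1) => /eqP Es's.
have E : (2%:R * a * b)%:A * s = (d' - a ^+ 2 - b ^+ 2 * d)%:A.
  rewrite !scalerBl !(algX, algM) -Es -Es' -Es's.
  have -> : (2%:R)%:A = 2%:R :> L by exact: (rmorph_nat (in_alg L)).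
  ring.
have [ab0|nzab] := eqVneq (2%:R * a * b) 0; last first.
  case/negP: sN1; have -> : s = ((2%:R * a * b)^-1 * (d' - a ^+ 2 - b ^+ 2 * d))%:A.
    by rewrite -scalerA -E mulr_algl scalerA mulVf // scale1r.
  exact: alg_in1v.
have {}E : d' - a ^+ 2 - b ^+ 2 * d = 0.
  by apply: (@alg_inj L); rewrite -E ab0 scale0r mul0r.
move/eqP: ab0; rewrite !mulf_eq0 (negPf nz2) /= => /orP[/eqP a0|/eqP b0].
  by exists b; apply/eqP; rewrite -subr_eq0 -E a0 expr0n subr0.
by case/negP: s'N1; rewrite -Es's b0 scale0r mul0r addr0 alg_in1v.
Qed.

End SquareRoots.

(** * The discriminant of Phi and the fields generated by its roots *)

Section Discriminant.
Variables (k : fieldType) (Phi : polymap k).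
Hypothesis nz2 : 2%:R != 0 :> k.
Hypothesis PhiP : is_Phi Phi.

Definition disc (K : fieldType) (q : 'rV[K]_3) : K :=
  q 0 1 ^+ 2 - 4%:R * q 0 0 * q 0 2%:R.

Lemma disc_sym2 (K : fieldType) (g : 'M[K]_2) q :
  disc (sym2 g q) = \det g ^+ 2 * disc q.
Proof. by rewrite /disc /sym2 /sym_mul det2E !mxE /=; ring. Qed.

Lemma discZ (K : fieldType) (c : K) q : disc (c *: q) = c ^+ 2 * disc q.
Proof. by rewrite /disc !mxE; ring. Qed.

Lemma disc_map (K K' : fieldType) (f : {rmorphism K -> K'}) q :
  disc (map_mx f q) = f (disc q).
Proof. by rewrite /disc !mxE rmorphB !rmorphM rmorph_nat. Qed.

Definition mapV (K : fieldType) (iota : {rmorphism k -> K}) (x : V k) : V K :=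
  (map_mx iota x.1, [ffun i => map_mx iota (x.2 i)]).

Lemma delta_mapV (K : fieldType) (iota : {rmorphism k -> K}) x :
  delta (mapV iota x) = iota (delta x).
Proof.
rewrite /delta /P1 /P2 /polar_det /= !ffunE !mxE.
rewrite -!map_mxZ -map_mxB -!map_mxD !det_map_mx.
by rewrite rmorphN rmorphM !(rmorphB, rmorphD, rmorphM, rmorphXn, rmorph_nat).
Qed.

Lemma polymap_at_mapV (K : fieldType) (iota : {rmorphism k -> K}) x :
  polymap_at iota Phi (mapV iota x) = map_mx iota (polymap_at idfun Phi x).
Proof.
apply/rowP => l; rewrite !mxE /mmap rmorph_sum; apply: eq_bigr => m _.
rewrite rmorphM rmorph_prod; congr (_ * _); apply: eq_bigr => i _.
rewrite rmorphXn; congr (_ ^+ _); rewrite /Vcoord.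
rewrite -[i]splitK; case: (split i) => j /=; first by rewrite !row_mxEl mxE.
rewrite !row_mxEr; case/mxvec_indexP: j => a b; rewrite !mxvecE !mxE.
by case/mxvec_indexP: b => b c; rewrite !mxvecE ffunE mxE.
Qed.

Lemma disc_Phi x : nonsingular x -> disc (polymap_at idfun Phi x) = delta x.
Proof.
move=> nsx; have [PhiR PhiE] := PhiP.
(* Phi is known on the orbit of R only, and x enters it over k(sqrt(delta x)). *)
have [L [s Es _]] := sqrt_fields_exists (delta x).
have nz2L : 2%:R != 0 :> L by rewrite -(rmorph_nat (in_alg L)) fmorph_eq0.
have nzs : s != 0.
  by rewrite -sqrf_eq0 Es scaler_eq0 negb_or oner_neq0 delta_neq0.
have dx : delta (mapV (in_alg L) x) = s ^+ 2 by rewrite delta_mapV Es.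
have nsR : nonsingular (@Rpt L).
  by apply: nonsingular_delta; rewrite delta_Rpt oner_neq0.
have [||g Gg xE] := @Gorbit_delta L Rpt (mapV (in_alg L) x) s nz2L nsR _ nzs.
- by apply: nonsingular_delta; rewrite dx expf_neq0.
- by rewrite delta_Rpt mulr1.
apply: (fmorph_inj (in_alg L)); rewrite -disc_map -polymap_at_mapV -delta_mapV.
(* The value of Phi at R is given over k, and is carried to L by base change. *)
have RE : mapV (in_alg L) Rpt = Rpt.
  congr (_, _); first exact: map_delta_mx.
  apply/ffunP => i; rewrite !ffunE; elim/ord3_ind: i => /=;
   by rewrite ?map_mxD ?map_mxN !map_delta_mx.
(* The discriminant of Phi and [delta] both scale by the square of t (\det g_1)^2 (\det g_2)^2 (\det
   g_3)^2, and both equal 1 at R. *)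
rewrite xE PhiE // -RE polymap_at_mapV PhiR map_delta_mx RE discZ disc_sym2.
rewrite delta_Vact delta_Rpt /disc !mxE /=; ring.
Qed.

(** For a nonzero, 2 a r + b is a square root of the discriminant and generates the same field as
    the root r. For a = 0 the discriminant is b^2, the roots [1 : 0] and [-c : b] are rational, and
    both sides say that L is k. *)
Lemma root_fieldsE x : nonsingular x -> root_fields Phi x = sqrt_fields (delta x).
Proof.
move=> nsx; have := disc_Phi nsx; have := delta_neq0 nsx.
rewrite /root_fields; move: (delta x) (polymap_at _ _ x) => d q nzd dq.
apply: functional_extensionality => L; apply: propositional_extensionality.
pose a : L := (q 0 0)%:A; pose b : L := (q 0 1)%:A; pose c : L := (q 0 2%:R)%:A.
have dE : d%:A = b ^+ 2 - 4%:R * a * c.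
  transitivity (in_alg L (disc q)); first by rewrite dq.
  by rewrite -disc_map /disc !mxE.
have nz2L : 2%:R != 0 :> L by rewrite -(rmorph_nat (in_alg L)) fmorph_eq0.
have nzdL : d%:A != 0 :> L by rewrite scaler_eq0 negb_or nzd oner_neq0.
have [a1 b1 c1] : [/\ a \in 1%VS, b \in 1%VS & c \in 1%VS].
  by split; exact: alg_in1v.
have qE (r1 r2 : L) : bqf_eval (map_mx (in_alg L) q) r1 r2 =
   a * r1 ^+ 2 + b * r1 * r2 + c * r2 ^+ 2 by rewrite /bqf_eval !mxE.
have gen1 (u v : L) : u \in 1%VS -> v \in 1%VS -> <<1; u>>%VS = <<1; v>>%VS.
  by move=> u1 v1; rewrite (Fadjoin_idP u1) (Fadjoin_idP v1).
have gen_sqrt (u : L) : a != 0 -> <<1; 2%:R * a * u + b>>%VS = <<1; u>>%VS.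
  move=> nza; have n1 n (U : {subfield L}) : n%:R \in U by rewrite rpred_nat.
  have sub1 (v w : L) : v \in 1%VS -> v \in <<1; w>>%VS by exact: subvP_adjoin.
  apply/eqP; rewrite eqEsubv; apply/andP; split; apply/FadjoinP; split;
    rewrite ?subv_adjoin //.
    by rewrite rpredD ?rpredM ?memv_adjoin ?n1 ?sub1.
  have nz : 2%:R * a != 0 by rewrite mulf_neq0.
  rewrite -[X in X \in _](mulKf nz) -[X in _ * X](addrK b).
  by rewrite rpredM ?rpredV ?rpredB ?rpredM ?memv_adjoin ?n1 ?sub1.
split=> [[r1 [r2 [nzr]]]|[s Es gen]].
  rewrite qE => r0 gen.
  (* At the point at infinity, [r1 / r2] is 0 by convention and generates k. *)
  have [r20|nzr2] := eqVneq r2 0.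
    have a0 : a = 0.
      move: nzr r0; rewrite r20 xpair_eqE eqxx andbT => nzr1.
      rewrite expr0n !mulr0 !addr0 => /eqP.
      by rewrite mulf_eq0 expf_eq0 /= (negPf nzr1) orbF => /eqP.
    exists b; first by rewrite dE a0 mulr0 mul0r subr0.
    by rewrite -gen r20 invr0 mulr0; apply: gen1 => //; exact: mem0v.
  pose r := r1 / r2; have rr : a * r ^+ 2 + b * r + c = 0.
    apply: (mulIf (expf_neq0 2 nzr2)); rewrite mul0r -r0 /r.
    by field.
  have [a0|nza] := eqVneq a 0; last first.
    exists (2%:R * a * r + b); last by rewrite gen_sqrt.
    by rewrite dE -[LHS]subr0 -(mulr0 (4%:R * a)) -rr; ring.
  exists b; first by rewrite dE a0 mulr0 mul0r subr0.
  rewrite -gen; apply: gen1 => //; rewrite -/r.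
  have nzb : b != 0.
    by apply: contraNneq nzdL => b0; rewrite dE a0 b0 expr0n mulr0 mul0r subr0.
  have -> : r = - c / b.
    apply: (canRL (mulfK nzb)); apply/eqP.
    by rewrite -addr_eq0 mulrC -rr a0 mul0r add0r.
  by rewrite rpredM ?rpredN ?rpredV.
have [a0|nza] := eqVneq a 0.
  exists 1, 0; split; first by rewrite xpair_eqE oner_eq0.
    by rewrite qE a0 expr0n !mulr0 mul0r !addr0.
  rewrite -gen invr0 mulr0; apply: gen1; first exact: mem0v.
  have : (s == b) || (s == - b) by rewrite -eqf_sqr Es dE a0 mulr0 mul0r subr0.
  by case/orP => /eqP ->; rewrite ?rpredN.
exists ((s - b) / (2%:R * a)), 1; split.
- by rewrite xpair_eqE oner_eq0 andbF.
- rewrite qE; apply: (mulfI (mulf_neq0 nz2L (mulf_neq0 nz2L nza))).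
  rewrite mulr0.
  transitivity ((s ^+ 2 - (b ^+ 2 - 4%:R * a * c))); last by rewrite Es dE subrr.
  by field; apply/andP.
- rewrite divr1 -gen_sqrt // mulrC divfK ?subrK //.
  by rewrite mulf_neq0.
Qed.

End Discriminant.

(** * From orbits to isomorphism classes of extensions, through square classes *)

Theorem proposition10p6 (k : fieldType) (char_k : 2%N \notin [pchar k])
    (Phi : polymap k) (PhiP : is_Phi Phi) :
  exists F : (V k -> Prop) -> (fieldExtType k -> Prop),
    (forall x : V k, nonsingular x -> F (Gorbit x) = root_fields Phi x) /\
    bij_between (@nonsingular_orbits k) (@Ex2 k) F.
Proof.
have nz2 : 2%:R != 0 :> k by move: char_k; rewrite inE.
have orbit_sqrt (x y : V k) : Gorbit x y ->
    nonsingular x -> exists2 c, c != 0 & delta y = c ^+ 2 * delta x.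
  case=> g [d1 d2 d3 dt] -> _; rewrite delta_Vact; eexists; last reflexivity.
  by rewrite !mulf_neq0 ?expf_neq0 // -unitfE -unitmxE.
have sqrt_scale c d (L : fieldExtType k) : c != 0 ->
    sqrt_fields d L -> sqrt_fields (c ^+ 2 * d) L.
  move=> nzc [s Es gen]; exists (c *: s); first by rewrite exprZn Es scalerA.
  rewrite -gen; apply/eqP; rewrite eqEsubv; apply/andP; split; apply/FadjoinP;
    split; rewrite ?subv_adjoin //; first by rewrite memvZ ?memv_adjoin.
  by rewrite -[X in X \in _](scalerK nzc) memvZ ?memv_adjoin.
(* Quantifying over representatives defines F on orbits without choosing one; [FE] shows that all of
   them give the same extensions. *)
pose F (O : V k -> Prop) (L : fieldExtType k) :=
  exists x, [/\ nonsingular x, O = Gorbit x & root_fields Phi x L].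
have FE x : nonsingular x -> F (Gorbit x) = root_fields Phi x.
  move=> nsx; apply: functional_extensionality => L.
  apply: propositional_extensionality; split; last by exists x.
  case=> y [nsy Oxy]; rewrite !root_fieldsE //.
  have [c nzc ->] : exists2 c, c != 0 & delta x = c ^+ 2 * delta y.
    by apply: orbit_sqrt nsy; rewrite -Oxy; exact: Gorbit_refl.
  exact: sqrt_scale.
exists F; split=> //; split.
- move=> _ [x nsx ->]; rewrite FE // root_fieldsE //.
  have [L sL] := sqrt_fields_exists (delta x).
  exists L; first exact: (sqrt_fields_Ex2 nz2 (delta_neq0 nsx) sL).
  apply: functional_extensionality => L'.
  apply: propositional_extensionality; split => [|i]; first exact: sqrt_fields_iso.
  exact: ext_iso_sqrt i sL.
- move=> _ _ [x nsx ->] [y nsy ->]; rewrite !FE // !root_fieldsE // => E.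
  (* A single L belonging to both classes puts the two values of [delta] in one square class. *)
  have [L sL] := sqrt_fields_exists (delta x).
  have sL' : sqrt_fields (delta y) L by rewrite -E.
  have [c nzc dE] := sqrt_fields_square nz2 (delta_neq0 nsx) (delta_neq0 nsy) sL sL'.
  have xy := Gorbit_delta nz2 nsx nsy nzc dE.
  apply: functional_extensionality => z; apply: propositional_extensionality.
  by split; apply: Gorbit_trans; [exact: Gorbit_sym|].
(* Surjectivity: the preimage of k(sqrt d) is the orbit of [normal_pt d]. *)
- move=> _ [L [_ dL] ->]; have [d nzd sL] := Ex2_sqrt nz2 dL.
  have nsx := nonsingular_normal_pt nzd.
  exists (Gorbit (normal_pt d)); first by exists (normal_pt d).
  rewrite FE // root_fieldsE // delta_normal_pt.
  apply: functional_extensionality => L'.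
  apply: propositional_extensionality; split => [|i]; first exact: sqrt_fields_iso.
  exact: ext_iso_sqrt i sL.
Qed.
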